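(* Let $0\le k\le n$ be integers with $n\ge 1$. Smooth torus orbit closures in $G_k(\mathbb{C}^n)$ are uniquely determined by their corresponding (simple) matroid polytopes: if $X,Y\in G_k(\mathbb{C}^n)$ are such that $\overline{TX}$ and $\overline{TY}$ are smooth and $\mu(\overline{TX})=\mu(\overline{TY})$, then $\overline{TX}=\overline{TY}$.
   Context: $G_k(\mathbb{C}^n)$ is the Grassmannian of $k$-dimensional complex linear subspaces of $\mathbb{C}^n$. $T=(\mathbb{C}^* )^n$ acts on $\mathbb{C}^n$ by coordinatewise multiplication and hence acts on $G_k(\mathbb{C}^n)$. $TX$ is the $T$-orbit of $X$ and $\overline{TX}$ is its closure in $G_k(\mathbb{C}^n)$, regarded as a (reduced) subvariety. For $J\subset[n]=\{1,\dots,n\}$, $\delta_J\in\mathbb{R}^n$ is the indicator vector of $J$. Represent $X\in G_k(\mathbb{C}^n)$ by an $n\times k$ matrix $A$ whose columns form a basis of $X$; for a $k$-element subset $J$ of $[n]$, $P^J(X)$ is the $k\times k$ minor of $A$ formed by the rows with indices in $J$ (well defined up to a common nonzero factor; for $k=0$ the empty minor is $1$). The moment map $\mu\colon G_k(\mathbb{C}^n)\to\mathbb{R}^n$ is $$\mu(X)=\frac{\sum_{J\subset[n],\,|J|=k}|P^J(X)|^2\,\delta_J}{\sum_{J\subset[n],\,|J|=k}|P^J(X)|^2}.$$ It is known that $\mu(\overline{TX})$ is the convex hull of $\{\delta_J\mid P^J(X)\ne0\}$; it is called the matroid polytope corresponding to $\overline{TX}$. *)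

(* Defs.v *)
From mathcomp Require Import all_boot all_order all_algebra.
From mathcomp Require Import classical_sets reals complex mpoly.

Set Implicit Arguments.
Unset Strict Implicit.
Unset Printing Implicit Defensive.

Import GRing.Theory Num.Theory.
Local Open Scope ring_scope.
Local Open Scope classical_set_scope.

(* Varieties are sets of closed points over an algebraically closed field, with
   their Zariski topology. Affine space A^d is 'rV[F]_d, and 'X_i stands for
   the coordinate of index (0, i). *)
Section AffineVarieties.
Variables (F : fieldType) (d : nat).
Implicit Types (S Z : set 'rV[F]_d) (x v : 'rV[F]_d) (f : {mpoly F[d]}).

Definition zeros (I : set {mpoly F[d]}) : set 'rV[F]_d :=
  [set x | forall f, I f -> f.@[x 0] = 0].

Definition affine_closed S : Prop := exists I, S = zeros I.

(* The full ideal of S, hence radical: S carries its reduced structure. *)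
Definition vanishing_ideal S : set {mpoly F[d]} :=
  [set f | forall x, S x -> f.@[x 0] = 0].

Definition irreducible_closed Z : Prop :=
  [/\ affine_closed Z, Z !=set0 &
      forall Z1 Z2, affine_closed Z1 -> affine_closed Z2 ->
        Z `<=` Z1 `|` Z2 -> Z `<=` Z1 \/ Z `<=` Z2].

(* C 0 `<` ... `<` C r is a chain of irreducible closed subsets of S through x;
   it corresponds to a chain of r + 1 prime ideals of the local ring of S
   at x. *)
Definition irreducible_chain S x (r : nat) (C : nat -> set 'rV[F]_d) : Prop :=
  [/\ C 0%N x,
      forall i, (i <= r)%N -> irreducible_closed (C i) /\ C i `<=` S &
      forall i, (i < r)%N -> C i `<` C i.+1].

(* The Krull dimension of the local ring of S at x is r. *)
Definition local_dim S x (r : nat) : Prop :=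
  (exists C, irreducible_chain S x r C) /\
  (forall m C, irreducible_chain S x m C -> (m <= r)%N).

Definition zariski_tangent S x : set 'rV[F]_d :=
  [set v | forall f, vanishing_ideal S f ->
             \sum_(i < d) (f^`M(i)).@[x 0] * v 0 i = 0].

Definition smooth_at S x : Prop :=
  exists U : {vspace 'rV[F]_d},
    zariski_tangent S x = [set v | v \in U] /\ local_dim S x (\dim U).

Definition affine_smooth S : Prop := forall x, S x -> smooth_at S x.

End AffineVarieties.

Section Grassmannian.
Variables (F : fieldType) (n k : nat).

Definition Gr : Type := {X : {vspace 'cV[F]_n} | \dim X == k}.

(* For #|J| = k, the affine chart of Gr centred at the coordinate subspace of
   J, i.e. the column span of the matrices whose block of rows J is 1%:M. The
   entry (i, j) of the complementary block, i ranging over ~: J and j over J,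
   is the coordinate of index mxvec_index i j. *)
Definition chart_col (J : {set 'I_n}) (x : 'rV[F]_(#|~: J| * #|J|))
    (j : 'I_#|J|) : 'cV[F]_n :=
  delta_mx (enum_val j) 0
  + \sum_(i < #|~: J|) vec_mx x i j *: delta_mx (enum_val i) 0.

Definition chart (J : {set 'I_n}) (x : 'rV[F]_(#|~: J| * #|J|)) :
    {vspace 'cV[F]_n} :=
  <<[seq chart_col x j | j : 'I_#|J|]>>%VS.

Definition in_chart (J : {set 'I_n}) (V : set Gr) :
    set 'rV[F]_(#|~: J| * #|J|) :=
  [set x | exists2 X : Gr, V X & val X = chart x].

Arguments in_chart J V : clear implicits.

Definition gr_closed (V : set Gr) : Prop :=
  forall J : {set 'I_n}, #|J| = k -> affine_closed (in_chart J V).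

Definition gr_closure (V : set Gr) : set Gr :=
  [set X | forall W, gr_closed W -> V `<=` W -> W X].

Definition gr_smooth (V : set Gr) : Prop :=
  forall J : {set 'I_n}, #|J| = k -> affine_smooth (in_chart J V).

Definition torus_orbit (X : Gr) : set Gr :=
  [set Y | exists2 t : 'rV[F]_n, (forall i, t 0 i != 0) &
             val Y = (linfun (mulmx (diag_mx t)) @: val X)%VS].

(* For F the complex numbers, this is also the closure for the classical
   topology, orbits being constructible. *)
Definition orbit_closure (X : Gr) : set Gr := gr_closure (torus_orbit X).

(* P^J(X), computed in the basis vbasis X; meaningful for #|J| = k, in which
   case the matrix consists of the rows J of the n x k matrix of that basis. *)
Definition plucker (X : Gr) (J : {set 'I_n}) : F :=
  \det (\matrix_(i < #|J|, j < #|J|) (vbasis (val X))`_j (enum_val i) 0).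

End Grassmannian.

Section MomentMap.
Variables (R : realType) (n k : nat).

Definition indicator (J : {set 'I_n}) : 'rV[R]_n := \row_i (i \in J)%:R.

Definition plucker_weight (X : Gr R[i] n k) (J : {set 'I_n}) : R :=
  Normc.normc (plucker X J) ^+ 2.

Definition moment_map (X : Gr R[i] n k) : 'rV[R]_n :=
  (\sum_(J : {set 'I_n} | #|J| == k) plucker_weight X J)^-1 *:
    \sum_(J : {set 'I_n} | #|J| == k) plucker_weight X J *: indicator J.

End MomentMap.

(* Main.v *)
Require Import Defs.
From HB Require Import structures.
From mathcomp Require Import all_boot all_order all_algebra.
From mathcomp Require Import classical_sets boolp reals complex mpoly.

Set Implicit Arguments.
Unset Strict Implicit.
Unset Printing Implicit Defensive.

Import Order.TTheory GRing.Theory Num.Theory.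
Local Open Scope ring_scope.
Local Open Scope classical_set_scope.

(* If X lies in the affine chart centred at the coordinate subspace of J, say
   X = chart x, then T acts on the chart diagonally, the coordinate (i, j) having
   weight e_i - e_j, and the origin is a limit of the orbit of X. The closure of
   the orbit contains the coordinate axes of all nonzero coordinates of x, so
   that its tangent space at the origin is spanned by them. If it is smooth
   there, it is therefore dense in their span, hence satisfies no binomial
   equation in these coordinates, i.e. their weights are linearly independent.
   Then T acts transitively on the vectors with the same support as x. Finally
   this support and the charts containing X are determined by the moment map
   image, which contains the vertex of J exactly when X lies in the chart of J:
   the coordinate (i, j) of x vanishes if and only if X is not in the chart of
   J - j + i. *)

(** * Algebraic dependence and chains of prime ideals *)

Section AlgebraicDependence.
Variable F : fieldType.

(* Exponent vectors of length r with entries below N, as nested pairs, so that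
   inductions on r peel off the first variable. *)
Fixpoint exponents (N r : nat) : finType :=
  if r is r'.+1 then ('I_N * exponents N r')%type : finType else unit : finType.

Fixpoint power_product (A : comNzRingType) (N r : nat) :
    (nat -> A) -> exponents N r -> A :=
  match r with
  | 0 => fun _ _ => 1
  | r'.+1 => fun a e => a 0%N ^+ e.1 * power_product (fun i => a i.+1) e.2
  end.

Lemma card_exponents N r : #|exponents N r| = (N ^ r)%N.
Proof.
elim: r => [|r IHr]; first by rewrite card_unit.
by rewrite /= card_prod card_ord IHr expnS.
Qed.

Lemma rmorph_power_product (A B : comNzRingType) (f : {rmorphism A -> B}) N r
    (a : nat -> A) (e : exponents N r) :
  f (power_product a e) = power_product (f \o a) e.
Proof.
elim: r a e => [|r IHr] a e /=; first by rewrite rmorph1.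
by rewrite rmorphM rmorphXn IHr.
Qed.

(** [msize] is the degree plus one, and 0 for the zero polynomial. Bounds with a successor let
    degrees add and cover the zero polynomial as well. *)
Lemma msizeM_leS m (p q : {mpoly F[m]}) d1 d2 :
  (msize p <= d1.+1)%N -> (msize q <= d2.+1)%N -> (msize (p * q) <= (d1 + d2).+1)%N.
Proof.
have [->|p0] := eqVneq p 0; first by rewrite mul0r msize0.
have [->|q0] := eqVneq q 0; first by rewrite mulr0 msize0.
move=> hp hq; rewrite msizeM // -subn1 leq_subLR.
by rewrite (leq_trans (leq_add hp hq)) // addSn addnS.
Qed.

Lemma msize_power_product m N r D (a : nat -> {mpoly F[m]}) (e : exponents N r) :
  (forall i, (i < r)%N -> (msize (a i) <= D.+1)%N) ->
  (msize (power_product a e) <= (r * N * D).+1)%N.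
Proof.
elim: r a e => [|r IHr] a e aD /=; first by rewrite msize1.
rewrite mulSn mulnDl; apply: msizeM_leS; last first.
  by apply: IHr => i ir; apply: aD.
have le1 i : (msize (a 0%N ^+ i) <= (i * D).+1)%N.
  elim: i => [|i IHi]; first by rewrite expr0 msize1.
  by rewrite exprS mulSn msizeM_leS // aD.
by rewrite (leq_trans (le1 _)) // ltnS leq_mul2r ltnW ?orbT.
Qed.

(* There are N ^ r power products, and for a suitable constant C they lie in a
   space of dimension at most (C N) ^ m, which is smaller for N large. *)
Lemma power_products_dependent m r (a : nat -> {mpoly F[m]}) : (m < r)%N ->
  exists N (c : exponents N r -> F),
    (exists e, c e != 0) /\ \sum_e c e *: power_product a e = 0.
Proof.
move=> mr; pose D := (\max_(i < r) msize (a i))%N.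
have aD i : (i < r)%N -> (msize (a i) <= D.+1)%N.
  by move=> ir; rewrite leqW // (leq_bigmax (Ordinal ir)).
(* Power products have degree at most [r * N * D], so each exponent takes at most [C * N] values.
   The choice of [N] gives (C N)^m = C^m N^m < N^(m+1) <= N^r. *)
pose C := (r * D).+1; pose N := (C ^ m).+1; exists N.
pose mon (u : {ffun 'I_m -> 'I_(r * N * D).+1}) := [multinom (u i : nat) | i < m].
pose M := \matrix_(i < #|exponents N r|, j < #|{ffun 'I_m -> 'I_(r * N * D).+1}|)
  (power_product a (enum_val i))@_(mon (enum_val j)).
have : kermx M != 0.
  rewrite kermx_eq0 /row_free neq_ltn (leq_ltn_trans (rank_leq_col M)) //.
  rewrite card_ffun !card_ord card_exponents.
  apply: (@leq_ltn_trans ((C * N) ^ m)%N).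
    have [->|m_gt0] := posnP m; first by rewrite !expn0.
    rewrite leq_exp2r //.
    by rewrite mulnAC mulSn addnC -addn1 leq_add2l.
  rewrite expnMn (@leq_trans (N * N ^ m)%N) ?ltn_mul2r ?expn_gt0 //=.
  by rewrite -expnS leq_pexp2l.
case/rowV0Pn=> v /sub_kermxP vM0 v0.
exists (fun e => v 0 (enum_rank e)); split.
  case/rV0Pn: v0 => i vi; exists (enum_val i); by rewrite enum_valK.
apply/mpolyP => u; rewrite mcoeff0 raddf_sum /=.
under eq_bigr do rewrite mcoeffZ.
(* A monomial outside the box of exponents has larger degree than every power product, so its
   coefficients all vanish. *)
have [/forallP ule|] := boolP [forall i, (u i < (r * N * D).+1)%N]; last first.
  case/forallPn => i; rewrite -leqNgt => ui.
  rewrite big1 // => e _; apply/eqP; rewrite mulf_eq0; apply/orP; right.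
  rewrite mcoeff_eq0; apply: msize_mdeg_ge.
  rewrite (leq_trans (msize_power_product e aD)) // (leq_trans ui) //.
  by rewrite mdegE (bigD1 i) //= leq_addr.
pose w := [ffun i => Ordinal (ule i)].
have -> : u = mon w by apply/mnmP => i; rewrite mnmE ffunE.
have := congr1 (fun A : 'rV_ _ => A 0 (enum_rank w)) vM0.
rewrite !mxE => {2}<-; rewrite (reindex enum_rank) /=; last first.
  by apply: onW_bij; apply: enum_rank_bij.
by apply: eq_bigr => e _; rewrite mxE !enum_rankK.
Qed.

Definition prime_ideal (A : comNzRingType) (P : set A) : Prop :=
  [/\ P 0, forall x y, P x -> P y -> P (x + y), forall x y, P y -> P (x * y),
      ~ P 1 & forall x y, P (x * y) -> P x \/ P y].

(* This is half of the Coquand-Lombardi characterization of Krull dimension: a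
   relation between the a_i modulo P_0, divided by the lowest power of a_0 that
   occurs, gives a relation between the remaining a_i modulo P_1. *)
Lemma power_products_independent (A : comAlgType F) (P : nat -> set A) N r
    (a : nat -> A) (c : exponents N r -> F) :
  (forall i, (i <= r)%N -> prime_ideal (P i)) ->
  (forall i, (i < r)%N -> [/\ P i `<=` P i.+1, P i.+1 (a i) & ~ P i (a i)]) ->
  P 0%N (\sum_e c e *: power_product a e) -> forall e, c e = 0.
Proof.
elim: r P a c => [|r IHr] P a c prP aP.
  case: (prP 0%N (leqnn _)) => _ _ PM P1 _ + [].
  rewrite (big_pred1 tt) /=; last by case.
  move=> Pc; apply/eqP; apply: contrapT => /negP c0; apply: P1.
  rewrite -(scale1r 1) -(mulVf c0) -scalerA.
  by rewrite -[X in _ *: X]mul1r scalerAl; apply: PM.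
pose q i := \sum_j c (i, j) *: power_product (fun i => a i.+1) j.
have -> : \sum_e c e *: power_product a e = \sum_(i < N) a 0%N ^+ i * q i.
  transitivity (\sum_(i < N) \sum_(j : exponents N r)
      c (i, j) *: power_product a ((i, j) : exponents N r.+1)).
    by rewrite pair_bigA; apply: eq_bigr; case.
  apply: eq_bigr => i _; rewrite mulr_sumr; apply: eq_bigr => j _.
  by rewrite -scalerAr.
move=> Pq.
(* Here [i] bounds the exponents of [a 0] already treated; once they are gone, [a 0 ^+ i] divides
   what is left. *)
suff cq i j : (i <= N)%N -> (j < i)%N -> forall (jN : (j < N)%N) e, c (Ordinal jN, e) = 0.
  by case=> -[j jN] e; apply: (cq N).
elim: i j => // i IHi j iN; rewrite ltnS leq_eqVlt => /predU1P[->{j}|ji]; last first.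
  by apply: IHi => //; apply: ltnW.
move=> jN; apply: (IHr (fun i => P i.+1) (fun i => a i.+1) (fun e => c (Ordinal jN, e))).
- by move=> j ?; apply: prP.
- by move=> j ?; apply: aP.
case: (prP 0%N isT) => _ _ P0M P01 P0p.
case: (prP 1%N isT) => P10 P1D P1M _ _.
case: (aP 0%N isT) => P0S P1a P0a.
have : P 0%N (a 0%N ^+ i * \sum_(l < N | (i <= l)%N) a 0%N ^+ (l - i) * q l).
  rewrite mulr_sumr; move: Pq; rewrite (bigID (fun l : 'I_N => (i <= l)%N)) /=.
  rewrite [X in _ + X]big1 ?addr0.
    by under eq_bigr => l il do rewrite -(subnKC il) exprD -mulrA.
  case=> l lN; rewrite -ltnNge => li; rewrite /q big1 ?mulr0 // => e _.
  by rewrite (IHi l) ?scale0r // ltnW.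
have aX l : ~ P 0%N (a 0%N ^+ l).
  by elim: l => [//|l IHl]; rewrite exprS => /P0p[].
move=> /P0p[/aX //|] /P0S; rewrite (bigD1 (Ordinal jN)) //= subnn expr0 mul1r.
set s := \sum_(l < N | _) _ => Pqs.
have Ps : P 1%N (- s).
  rewrite -mulN1r; apply: (P1M); rewrite /s; apply: big_ind => // l /andP[il /eqP li].
  have /subnSK <- : (i < l)%N.
    by rewrite ltn_neqAle il andbT; apply/eqP => E; apply: li; apply: val_inj.
  by rewrite exprS mulrC; apply: (P1M); rewrite mulrC; apply: (P1M).
by have := P1D _ _ Pqs Ps; rewrite addrK.
Qed.

End AlgebraicDependence.

(** * Dimension of affine sets *)

Section AffineGeometry.
Variables (F : fieldType) (d : nat).
Implicit Types (S Z : set 'rV[F]_d) (x : 'rV[F]_d) (f g : {mpoly F[d]}).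

Lemma prime_vanishing_ideal Z :
  irreducible_closed Z -> prime_ideal (vanishing_ideal Z).
Proof.
case=> _ [x Zx] irrZ; split.
- by move=> y _; rewrite meval0.
- by move=> f g Zf Zg y Zy; rewrite mevalD Zf // Zg // addr0.
- by move=> f g Zg y Zy; rewrite mevalM Zg // mulr0.
- by move=> /(_ x Zx)/eqP; rewrite meval1 oner_eq0.
move=> f g Zfg.
have sub h : Z `<=` zeros [set h] -> vanishing_ideal Z h.
  by move=> Zh y /Zh; apply.
have closed (h : {mpoly F[d]}) : affine_closed (zeros [set h]) by exists [set h].
case: (irrZ _ _ (closed f) (closed g)); last by move/sub; right.
  move=> y Zy; have /eqP := Zfg y Zy; rewrite mevalM mulf_eq0.
  by case/orP => /eqP h0; [left|right] => _ ->.
by move/sub; left.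
Qed.

Lemma vanishing_ideal_proper Z1 Z2 : affine_closed Z1 -> Z1 `<` Z2 ->
  exists f, vanishing_ideal Z1 f /\ ~ vanishing_ideal Z2 f.
Proof.
case=> I -> [_ /existsNP[x /not_implyP[Z2x /existsNP[f /not_implyP[If fx]]]]].
exists f; split; first by move=> y; apply.
by move=> /(_ x Z2x).
Qed.

Variable E : {set 'I_d}.

Definition supported_on : set 'rV[F]_d := [set x | forall i, i \notin E -> x 0 i = 0].

(* The sum is 'X_e for the unique e with enum_val e = i if i is in E, and is
   empty otherwise. *)
Definition coord_restrict f : {mpoly F[#|E|]} :=
  mmap (@mpolyC #|E| F) (fun i => \sum_(e < #|E| | enum_val e == i) 'X_e) f.

HB.instance Definition _ := GRing.RMorphism.copy coord_restrict
  (mmap (@mpolyC #|E| F) (fun i => \sum_(e < #|E| | enum_val e == i) 'X_e)).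

Lemma coord_restrictZ c f : coord_restrict (c *: f) = c *: coord_restrict f.
Proof. by rewrite /coord_restrict mmapZ mul_mpolyC. Qed.

Lemma coord_restrict_X e : coord_restrict 'X_(enum_val e) = 'X_e.
Proof.
rewrite /coord_restrict mmapX mmap1U (big_pred1 e) // => e'.
by rewrite (inj_eq enum_val_inj).
Qed.

Lemma meval_coord_restrict x f : supported_on x ->
  f.@[x 0] = (coord_restrict f).@[fun e => x 0 (enum_val e)].
Proof.
move=> xE; rewrite /coord_restrict /mmap raddf_sum mevalE /=.
apply: eq_bigr => m _; rewrite mevalM mevalC; congr (_ * _).
rewrite /mmap1 rmorph_prod; apply: eq_bigr => i _ /=.
rewrite rmorphXn /= raddf_sum /=; congr (_ ^+ _).
have [iE|iE] := boolP (i \in E); last first.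
  rewrite big1 ?xE // => e /eqP ei; move: iE; rewrite -ei.
  by rewrite enum_valP.
rewrite (big_pred1 (enum_rank_in iE i)) => [|e].
  by rewrite mevalXU enum_rankK_in.
by rewrite /= -(inj_eq enum_val_inj) enum_rankK_in.
Qed.

(** The vanishing ideals of [C r], ..., [C 0] increase strictly, and the kernel of [coord_restrict],
    which is prime, lies strictly below them because of [g]. Elements separating these r + 2 primes
    would have independent power products, yet r + 1 polynomials in [#|E| <= r] variables are
    dependent. *)
Lemma chain_length_bound S x r C g :
  S `<=` supported_on -> vanishing_ideal S g -> coord_restrict g != 0 ->
  irreducible_chain S x r C -> (r < #|E|)%N.
Proof.
move=> SE Sg g0 [_ irrC subC]; rewrite ltnNge; apply/negP => Er.
have [b bP] : {b : nat -> {mpoly F[d]} & forall i, (i < r)%N ->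
    vanishing_ideal (C i) (b i) /\ ~ vanishing_ideal (C i.+1) (b i)}.
  apply: (choice (P := fun i f => (i < r)%N -> _ f /\ ~ _ f)) => i.
  have [ir|] := boolP (i < r)%N; last by exists 0.
  have [[Ci _ _] _] := irrC i (ltnW ir).
  by have [f ?] := vanishing_ideal_proper Ci (subC i ir); exists f.
pose a i := if i is i'.+1 then b (r - i'.+1)%N else g.
pose P i := if i is i'.+1 then vanishing_ideal (C (r - i')%N)
  else [set f | coord_restrict f = 0].
have [N [c [[e ce] c0]]] := @power_products_dependent _ _ r.+1 (coord_restrict \o a) Er.
suff : forall e, c e = 0 by move=> /(_ e) ce0; rewrite ce0 eqxx in ce.
apply: (@power_products_independent F {mpoly F[d]} P N r.+1 a).
- case=> [|i] ir /=; last first.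
    by apply: prime_vanishing_ideal; case: (irrC (r - i)%N (leq_subr _ _)).
  split=> /=.
  + exact: rmorph0.
  + by move=> p q p0 q0; rewrite rmorphD /= p0 q0 addr0.
  + by move=> p q q0; rewrite rmorphM /= q0 mulr0.
  + by move/eqP; rewrite rmorph1 oner_eq0.
  + by move=> p q /eqP; rewrite rmorphM mulf_eq0 /= => /orP[]/eqP; [left|right].
- case=> [|i] ir /=.
    have [_ CS] := irrC r (leqnn r); rewrite subn0; split.
    + by move=> f f0 y Cy; rewrite meval_coord_restrict ?f0 ?meval0 //; apply/SE/CS.
    + by move=> y Cy; apply/Sg/CS.
    + by move/eqP; rewrite (negPf g0).
  have ir' : (r - i.+1 < r)%N by rewrite ltn_subrL /=; case: (r) ir.
  have [? ?] := bP _ ir'; have := subC _ ir'; rewrite subnSK //.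
  case=> CC _; split=> //; first by move=> f Cf y Cy; apply/Cf/CC.
  by rewrite -(@subnSK i r ir).
rewrite -[P 0%N _]/(coord_restrict _ = 0) rmorph_sum -[RHS]c0.
apply: eq_bigr => e' _.
by rewrite -(rmorph_power_product coord_restrict) -coord_restrictZ.
Qed.

End AffineGeometry.

(** * Curves and tangent spaces *)

Section Curves.
Variables (F : numFieldType) (d : nat).
Implicit Types (S Z : set 'rV[F]_d) (x : 'rV[F]_d) (f g : {mpoly F[d]}).

Lemma poly_eq0_of_horner (p : {poly F}) : (forall a, a != 0 -> p.[a] = 0) -> p = 0.
Proof.
move=> p0; pose s : seq F := [seq i.+1%:R | i <- iota 0 (size p)].
apply: (@roots_geq_poly_eq0 _ _ s); last by rewrite size_map size_iota.
  by apply/allP => _ /mapP[i _ ->]; apply/rootP/p0; rewrite pnatr_eq0.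
by rewrite map_inj_uniq ?iota_uniq // => i j /eqP; rewrite eqr_nat => /eqP[].
Qed.

Definition mpoly_curve (q : 'I_d -> {poly F}) f : {poly F} := mmap polyC q f.

HB.instance Definition _ q := GRing.RMorphism.copy (mpoly_curve q) (mmap polyC q).

Lemma horner_mpoly_curve q f a : (mpoly_curve q f).[a] = f.@[fun i => (q i).[a]].
Proof.
rewrite /mpoly_curve /mmap horner_sum mevalE; apply: eq_bigr => m _.
rewrite hornerM hornerC; congr (_ * _); rewrite /mmap1 horner_prod.
by apply: eq_bigr => i _; rewrite horner_exp.
Qed.

(** Algebraic substitute for a limit as the parameter tends to 0: an equation pulled back to the
    curve is a polynomial in one variable with infinitely many roots. *)
Lemma affine_closed_curve Z (q : 'I_d -> {poly F}) : affine_closed Z ->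
  (forall a, a != 0 -> Z (\row_i (q i).[a])) -> Z (\row_i (q i).[0]).
Proof.
case=> I -> ZI f If.
have evalE a : f.@[(\row_i (q i).[a]) 0] = (mpoly_curve q f).[a].
  by rewrite horner_mpoly_curve; apply: meval_eq => i; rewrite mxE.
rewrite evalE (@poly_eq0_of_horner (mpoly_curve q f)) ?horner0 // => a /ZI.
by move=> /(_ f If); rewrite evalE.
Qed.

Definition axis (e : 'I_d) (i : 'I_d) : {poly F} := if i == e then 'X else 0.

(** The chain rule along a coordinate axis: the property holds for constants and variables and is
    stable under sums and products. *)
Lemma deriv_axis (e : 'I_d) f :
  (mpoly_curve (axis e) f)^`() = mpoly_curve (axis e) f^`M(e).
Proof.
pose D f := (mpoly_curve (axis e) f)^`() = mpoly_curve (axis e) f^`M(e).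
have D0 : D 0 by rewrite /D mderiv0 !rmorph0 deriv0.
have DC c : D c%:MP.
  by rewrite /D mderivC rmorph0 /mpoly_curve mmapC derivC.
have DD f1 f2 : D f1 -> D f2 -> D (f1 + f2).
  by rewrite /D => E1 E2; rewrite mderivD !rmorphD derivD E1 E2.
have DM f1 f2 : D f1 -> D f2 -> D (f1 * f2).
  by rewrite /D => E1 E2; rewrite mderivM rmorphD !rmorphM derivM E1 E2.
have DX i : D 'X_i.
  rewrite /D mderivX mnm1E {1}/mpoly_curve mmapX mmap1U /axis eq_sym.
  case: eqP => [->|_]; last by rewrite scale0r rmorph0 deriv0.
  by rewrite scale1r -{1}(add0m U_(i)%MM) addmK mpolyX0 rmorph1 derivX.
rewrite -/(D f); elim/mpolyind: f => // c m f _ _ Df.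
apply: DD Df; rewrite -mul_mpolyC; apply: (DM) => //.
rewrite mpolyXE_id; apply: (big_ind D) => [||i _]; first exact: (DC 1).
  by move=> *; apply: (DM).
elim: (m i) => [|k IHk]; first exact: (DC 1).
by rewrite exprS; apply: (DM).
Qed.

Lemma zariski_tangent_axis S e :
  (forall a, S (a *: delta_mx 0 e)) -> zariski_tangent S 0 (delta_mx 0 e).
Proof.
move=> Se f Sf; rewrite (bigD1 e) //= mxE !eqxx mulr1 big1 ?addr0; last first.
  by move=> i ie; rewrite mxE (negPf ie) andbF mulr0.
have axisE g a : (mpoly_curve (axis e) g).[a] = g.@[(a *: delta_mx 0 e : 'rV_d) 0].
  rewrite horner_mpoly_curve; apply: meval_eq => i; rewrite /axis !mxE eqxx /=.
  by case: eqP => _; rewrite ?hornerX ?horner0 ?mulr1 ?mulr0.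
have -> : (0 : 'rV[F]_d) = 0 *: delta_mx 0 e by rewrite scale0r.
rewrite -axisE -deriv_axis.
rewrite (@poly_eq0_of_horner (mpoly_curve (axis e) f)) ?deriv0 ?horner0 //.
by move=> a _; rewrite axisE Sf.
Qed.

(* The tangent space at 0 contains the coordinate subspace of E, so by
   smoothness the dimension of S is #|E| and S is dense in it. *)
Lemma smooth_at0_restrict_eq0 S (E : {set 'I_d}) g :
  S `<=` supported_on E -> (forall e a, e \in E -> S (a *: delta_mx 0 e)) ->
  smooth_at S 0 -> vanishing_ideal S g -> coord_restrict E g = 0.
Proof.
move=> SE axS [U [tanU [[C chainC] _]]] Sg; apply: contrapT => /eqP g0.
have := chain_length_bound SE Sg g0 chainC; apply/negP; rewrite -leqNgt.
(* The chain has length [\dim U], so it remains to find [#|E|] independent tangent vectors: the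
   directions of the axes. *)
pose T := [tuple (delta_mx 0 (enum_val i) : 'rV[F]_d) | i < #|E|].
have freeT : free T.
  apply/freeP => c c0 i; have /rowP/(_ (enum_val i)) := c0.
  rewrite summxE (bigD1 i) //= big1 ?addr0.
    by rewrite nth_mktuple !mxE !eqxx mulr1.
  move=> j ji; rewrite nth_mktuple !mxE (inj_eq enum_val_inj).
  by rewrite eq_sym (negPf ji) andbF mulr0.
have <- : \dim <<T>> = #|E| by rewrite (eqnP freeT) size_tuple.
apply: dimvS; apply/span_subvP => v /tnthP[i ->]; rewrite tnth_mktuple.
have : zariski_tangent S 0 (delta_mx 0 (enum_val i)).
  by apply: zariski_tangent_axis => a; apply: axS; apply: enum_valP.
by rewrite tanU.
Qed.

End Curves.

(** * Charts of the Grassmannian *)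

Section Charts.
Variables (F : fieldType) (n : nat).

Lemma memv_span_imageP (vT : vectType F) m (b : 'I_m -> vT) v :
  reflect (exists c : 'I_m -> F, v = \sum_j c j *: b j)
          (v \in <<[seq b j | j : 'I_m]>>%VS).
Proof.
have -> : [seq b j | j : 'I_m] = [tuple b j | j < m] by [].
apply: (iffP idP) => [/coord_span ->|[c ->]].
  exists (fun j => coord [tuple b j | j < m] j v).
  by apply: eq_bigr => j _; rewrite nth_mktuple.
apply: memv_suml => j _; apply/memvZ/memv_span.
by apply/tnthP; exists j; rewrite tnth_mktuple.
Qed.

Lemma memv_span_image (vT : vectType F) m (b : 'I_m -> vT) j :
  b j \in <<[seq b j | j : 'I_m]>>%VS.
Proof.
apply/memv_span_imageP; exists (fun l => (l == j)%:R).
rewrite (bigD1 j) //= eqxx scale1r big1 ?addr0 // => l /negPf ->.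
by rewrite scale0r.
Qed.

Lemma span_image_subvP (vT : vectType F) m (b : 'I_m -> vT) (U : {vspace vT}) :
  (forall j, b j \in U) -> (<<[seq b j | j : 'I_m]>> <= U)%VS.
Proof.
move=> bU; apply/subvP => _ /memv_span_imageP[c ->].
by apply: memv_suml => j _; apply: memvZ.
Qed.

Variable J : {set 'I_n}.
Implicit Types (x y : 'rV[F]_(#|~: J| * #|J|)) (b : 'I_#|J| -> 'cV[F]_n)
  (v : 'cV[F]_n).

Lemma enum_val_cover (i : 'I_n) :
  (exists j : 'I_#|J|, i = enum_val j) \/ (exists j : 'I_#|~: J|, i = enum_val j).
Proof.
have [iJ|iJ] := boolP (i \in J).
  by left; exists (enum_rank_in iJ i); rewrite enum_rankK_in.
have iC : i \in ~: J by rewrite inE.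
by right; exists (enum_rank_in iC i); rewrite enum_rankK_in.
Qed.

Lemma enum_val_disjoint (j : 'I_#|J|) (i : 'I_#|~: J|) :
  (enum_val j == enum_val i) = false.
Proof.
apply/eqP => ji; have := enum_valP i; rewrite -ji inE => /negP; apply.
exact: enum_valP.
Qed.

Lemma chart_col_in x j j' : chart_col x j (enum_val j') 0 = (j' == j)%:R.
Proof.
rewrite /chart_col !mxE eqxx andbT (inj_eq enum_val_inj) summxE big1 ?addr0 // => i _.
by rewrite !mxE enum_val_disjoint mulr0.
Qed.

Lemma chart_col_out x j (i : 'I_#|~: J|) :
  chart_col x j (enum_val i) 0 = vec_mx x i j.
Proof.
rewrite /chart_col !mxE eqxx andbT eq_sym enum_val_disjoint add0r summxE.
rewrite (bigD1 i) //= big1 ?addr0 => [|i' ii']; rewrite !mxE !eqxx ?mulr1 //.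
by rewrite (inj_eq enum_val_inj) eq_sym (negPf ii') mulr0.
Qed.

(** [chart x] is the graph of the linear map with matrix [vec_mx x] from the coordinates in [J] to
    the remaining ones. *)
Lemma memv_chartP x v :
  reflect (forall i : 'I_#|~: J|,
             v (enum_val i) 0 = \sum_j vec_mx x i j * v (enum_val j) 0)
          (v \in chart x).
Proof.
apply: (iffP (memv_span_imageP _ _)) => [[c ->] i|vE].
  rewrite summxE; apply: eq_bigr => j _; rewrite mxE chart_col_out.
  rewrite mulrC summxE; congr (_ * _).
  rewrite (bigD1 j) //= big1 ?addr0 => [|j' j'j]; rewrite mxE chart_col_in.
    by rewrite eqxx mulr1.
  by rewrite eq_sym (negPf j'j) mulr0.
exists (fun j => v (enum_val j) 0); apply/colP => i0; rewrite summxE.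
case: (enum_val_cover i0) => [[j ->]|[i ->]].
  rewrite (bigD1 j) //= big1 ?addr0 => [|j' j'j]; rewrite mxE chart_col_in.
    by rewrite eqxx mulr1.
  by rewrite eq_sym (negPf j'j) mulr0.
by rewrite vE; apply: eq_bigr => j _; rewrite [RHS]mxE chart_col_out mulrC.
Qed.

Lemma chart_col_memv x j : chart_col x j \in chart x.
Proof. exact: memv_span_image. Qed.

Lemma chart_inj : injective (@chart F n J).
Proof.
move=> x y xy; rewrite -(vec_mxK x) -(vec_mxK y); congr mxvec.
apply/matrixP => i j; rewrite -chart_col_out.
have := chart_col_memv x j; rewrite xy => /memv_chartP ->.
rewrite (bigD1 j) //= big1 ?addr0 => [|j' j'j]; rewrite chart_col_in.
  by rewrite eqxx mulr1.
by rewrite (negPf j'j) mulr0.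
Qed.

Lemma free_chart_col x : free [tuple chart_col x j | j < #|J|].
Proof.
apply/freeP => c c0 j; have /colP/(_ (enum_val j)) := c0.
rewrite summxE (bigD1 j) //= big1 ?addr0 => [|j' j'j];
  rewrite nth_mktuple mxE chart_col_in ?eqxx ?mulr1 ?mxE //.
by rewrite eq_sym (negPf j'j) mulr0.
Qed.

Lemma dim_chart x : \dim (chart x) = #|J|.
Proof. by have /eqnP := free_chart_col x; rewrite size_tuple. Qed.

Lemma eq0_chart x v : v \in chart x -> (forall i, i \in J -> v i 0 = 0) -> v = 0.
Proof.
move=> /memv_chartP vx vJ; apply/colP => i0; rewrite mxE.
case: (enum_val_cover i0) => [[j ->]|[i ->]]; first exact/vJ/enum_valP.
by rewrite vx big1 // => j _; rewrite vJ ?mulr0 ?enum_valP.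
Qed.

Definition rows_in b : 'M[F]_#|J| := \matrix_(i, j) b j (enum_val i) 0.
Definition rows_out b : 'M[F]_(#|~: J|, #|J|) := \matrix_(i, j) b j (enum_val i) 0.

Lemma det_rows_in_neq0 b : free [tuple b j | j < #|J|] ->
  (forall v, v \in <<[seq b j | j : 'I_#|J|]>>%VS ->
     (forall i, i \in J -> v i 0 = 0) -> v = 0) ->
  \det (rows_in b) != 0.
Proof.
move=> /freeP freeb trb; rewrite -det_tr; apply/det0P => -[c c0 cb].
case/eqP: c0; apply/rowP => j; rewrite mxE; apply: freeb.
under eq_bigr do rewrite nth_mktuple.
apply: trb => [|i iJ]; first by apply/memv_span_imageP; eexists.
have := congr1 (fun A : 'rV_ _ => A 0 (enum_rank_in iJ i)) cb.
rewrite !mxE summxE => cb0; rewrite -[RHS]cb0; apply: eq_bigr => l _.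
by rewrite !mxE enum_rankK_in.
Qed.

(** Column reduction: multiplying the basis matrix by the inverse of its block of rows [J] makes
    that block the identity, and the other block is then [x]. *)
Lemma span_eq_chartP b x : free [tuple b j | j < #|J|] ->
  <<[seq b j | j : 'I_#|J|]>>%VS = chart x <->
  \det (rows_in b) != 0 /\ x = mxvec (rows_out b *m invmx (rows_in b)).
Proof.
move=> freeb; set B := <<_>>%VS.
have bB j : b j \in B by exact: memv_span_image.
have bE y : (forall j, b j \in chart y) <-> rows_out b = vec_mx y *m rows_in b.
  split=> [by_|E j].
    apply/matrixP => i j; rewrite !mxE (memv_chartP _ _ (by_ j)).
    by apply: eq_bigr => l _; rewrite !mxE.
  apply/memv_chartP => i; have /matrixP/(_ i j) := E; rewrite !mxE => ->.
  by apply: eq_bigr => l _; rewrite !mxE.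
split=> [Bx|[dB ->]].
  have dB : \det (rows_in b) != 0.
    by apply: det_rows_in_neq0 => // v; rewrite -/B Bx; apply: eq0_chart.
  split=> //; have -> : rows_out b = vec_mx x *m rows_in b.
    by apply/bE => j; rewrite -Bx.
  by rewrite mulmxK ?vec_mxK // unitmxE unitfE.
apply/eqP; rewrite eqEdim dim_chart; apply/andP; split; last first.
  by have /eqnP := freeb; rewrite size_tuple => <-.
apply: span_image_subvP; apply: (proj2 (bE _)).
by rewrite mxvecK mulmxKV // unitmxE unitfE.
Qed.

End Charts.

(** * Charts, Plücker coordinates and basis exchange *)

Section GrassmannianCharts.
Variables (F : fieldType) (n k : nat).
Implicit Types (X Z : Gr F n k) (J : {set 'I_n}).

Definition has_chart X J : Prop := exists x, val X = chart (J := J) x.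

Definition gr_chart J (Jk : #|J| = k) (x : 'rV[F]_(#|~: J| * #|J|)) : Gr F n k :=
  exist (fun U : {vspace 'cV[F]_n} => \dim U == k) (chart x)
    (introT eqP (etrans (dim_chart x) Jk)).

Lemma vbasis_image X m : m = k ->
  [tuple (vbasis (val X))`_j | j < m] = vbasis (val X) :> seq _.
Proof.
move=> mk; apply: (@eq_from_nth _ 0) => [|i].
  by rewrite !size_tuple mk (eqP (valP X)).
rewrite size_tuple => im.
exact: (nth_mktuple (fun j : 'I_m => (vbasis (val X))`_j) 0 (Ordinal im)).
Qed.

Lemma free_vbasis_tuple X m : m = k -> free [tuple (vbasis (val X))`_j | j < m].
Proof. by move=> mk; rewrite vbasis_image //; apply: basis_free (vbasisP _). Qed.

Lemma span_vbasis_image X m : m = k ->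
  <<[seq (vbasis (val X))`_j | j : 'I_m]>>%VS = val X.
Proof.
move=> mk; rewrite -[RHS](span_basis (vbasisP _)) -[in RHS](vbasis_image X mk).
by [].
Qed.

Lemma plucker_neq0P X J : #|J| = k -> plucker X J != 0 <-> has_chart X J.
Proof.
move=> Jk; have fX := free_vbasis_tuple X Jk; split=> [dX|[x Xx]].
  eexists; rewrite -(span_vbasis_image X Jk).
  by apply/(span_eq_chartP _ fX); split.
have [] // := (span_eq_chartP x fX).1; by rewrite span_vbasis_image.
Qed.

Lemma has_chartP X J : #|J| = k ->
  has_chart X J <->
  (forall v : 'cV[F]_n, v \in val X -> (forall i, i \in J -> v i 0 = 0) -> v = 0).
Proof.
move=> Jk; split=> [[x ->] v|trX]; first exact: eq0_chart.
apply/plucker_neq0P => //; apply: det_rows_in_neq0; first exact: free_vbasis_tuple.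
by move=> v; rewrite span_vbasis_image //; apply: trX.
Qed.

(** A basis matrix of [X] has rank [k], so [k] of its rows form an invertible block. *)
Lemma has_chart_exists X : exists J, #|J| = k /\ has_chart X J.
Proof.
pose B : 'M[F]_(n, k) := \matrix_(i, j) (vbasis (val X))`_j i 0.
have rkB : row_full B.
  rewrite -[row_full B]/(\rank B == k) -mxrank_tr -/(row_free _).
  apply: inj_row_free => c cB.
  have /freeP fX := free_vbasis_tuple X (erefl k).
  apply/rowP => j; rewrite mxE; apply: (fX (fun j => c 0 j)).
  apply/colP => i; have /rowP/(_ i) := cB; rewrite !mxE summxE => cBi.
  by rewrite -[RHS]cBi; apply: eq_bigr => l _; rewrite nth_mktuple !mxE.
pose f := fullrankfun rkB; exists [set f j | j : 'I_k]%SET.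
have cf : #|[set f j | j : 'I_k]%SET| = k.
  by rewrite card_imset ?card_ord //; apply: fullrankfun_inj.
split=> //; apply/has_chartP => // v.
rewrite -(span_vbasis_image X (erefl k)) => /memv_span_imageP[c vE] v0.
suff c0 : \col_j c j = 0.
  rewrite vE big1 // => j _; have /colP/(_ j) := c0.
  by rewrite !mxE => ->; rewrite scale0r.
have : rowsub f B *m \col_j c j = 0.
  apply/colP => j; rewrite !mxE -[RHS](v0 (f j)) ?vE; last exact: imset_f.
  by rewrite summxE; apply: eq_bigr => l _; rewrite !mxE mulrC.
move/(congr1 (mulmx (invmx (rowsub f B)))).
by rewrite mulKmx ?mulmx0 // fullrowsub_unit.
Qed.

(** Up to sign, the coordinate (i, j) is the quotient of the Plücker coordinates of [J'] and [J].
    Thus the charts containing [X] determine the support of [x]. *)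
Lemma chart_exchange X J (x : 'rV[F]_(#|~: J| * #|J|)) (i : 'I_#|~: J|) (j : 'I_#|J|) :
  #|J| = k -> val X = chart x ->
  let J' := (enum_val i |: (J :\ enum_val j))%SET in
  #|J'| = k /\ (has_chart X J' <-> vec_mx x i j != 0).
Proof.
move=> Jk Xx J'; have iJ : enum_val i \notin J.
  by have := enum_valP i; rewrite inE.
have J'k : #|J'| = k.
  rewrite cardsU1 !inE (negPf iJ) andbF /= -Jk [RHS](cardsD1 (enum_val j)).
  by rewrite enum_valP.
split=> //; split=> [/has_chartP trX|xij].
  apply/eqP => x0; have := trX J'k (chart_col x j).
  rewrite Xx chart_col_memv => /(_ isT) c0.
  have /colP/(_ (enum_val j)) : chart_col x j = 0.
    apply: c0 => l; rewrite !inE => /orP[/eqP->|/andP[lj lJ]].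
      by rewrite chart_col_out.
    rewrite -(enum_rankK_in lJ lJ) chart_col_in.
    by rewrite -(inj_eq enum_val_inj) enum_rankK_in // (negPf lj).
  by rewrite chart_col_in eqxx mxE => /eqP; rewrite oner_eq0.
apply/has_chartP => // v; rewrite Xx => vx v0.
apply: (eq0_chart vx) => l lJ.
have [->|lj] := eqVneq l (enum_val j); last by apply: v0; rewrite !inE lj lJ orbT.
have /memv_chartP/(_ i) := vx; rewrite (v0 (enum_val i)) ?inE ?eqxx //.
rewrite (bigD1 j) //= big1 ?addr0.
  by move/esym/eqP; rewrite mulf_eq0 (negPf xij) => /eqP.
move=> j' j'j; rewrite (v0 (enum_val j')) ?mulr0 // !inE enum_valP.
by rewrite (inj_eq enum_val_inj) j'j orbT.
Qed.

(** For [j] in [J] but not in [J'], the j-th standard basis vector lies in the subspace and vanishes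
    on [J']. *)
Lemma has_chart_coordinate J (Jk : #|J| = k) J' : #|J'| = k ->
  has_chart (gr_chart Jk 0) J' -> J' = J.
Proof.
move=> J'k /has_chartP tr; apply/esym/eqP; rewrite eqEcard Jk J'k leqnn andbT.
apply/fintype.subsetP => j jJ; apply/negPn/negP => jJ'.
have /colP/(_ j) : (delta_mx j 0 : 'cV[F]_n) = 0.
  apply: tr => // [|i iJ'].
    apply/memv_chartP => i; rewrite !mxE big1 => [|l _]; last first.
      by rewrite raddf0 mxE mul0r.
    have := enum_valP i; rewrite inE andbT; case: eqP => // ->.
    by rewrite jJ.
  rewrite mxE andbT; case: eqP iJ' => // ->.
  by rewrite (negPf jJ').
by rewrite !mxE !eqxx => /eqP; rewrite oner_eq0.
Qed.

End GrassmannianCharts.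

(** * Closed conditions expressed in one chart *)

Section ClosedLoci.
Variables (F : fieldType) (n k : nat).
Implicit Types (X Z : Gr F n k) (J : {set 'I_n}).

(** Each monomial [m] of [g] is padded with [D ^+ (msize g - mdeg m)]; [msize g] exceeds all the
    degrees that occur. *)
Lemma clear_denominators d d' (g : {mpoly F[d]}) (N : 'I_d -> {mpoly F[d']})
    (D : {mpoly F[d']}) :
  exists h : {mpoly F[d']}, forall v, D.@[v] != 0 ->
    h.@[v] = D.@[v] ^+ msize g * g.@[fun e => (D.@[v])^-1 * (N e).@[v]].
Proof.
exists (\sum_(m <- msupp g) g@_m *: (D ^+ (msize g - mdeg m) * \prod_e N e ^+ m e)).
move=> v Dv; rewrite (mevalE _ g) raddf_sum mulr_sumr /=; apply: eq_big_seq => m mg.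
rewrite mevalZ mulrCA; congr (_ * _).
rewrite mevalM rmorphXn /= rmorph_prod /=.
under [in LHS]eq_bigr do rewrite rmorphXn /=.
under [in RHS]eq_bigr do rewrite /= exprMn exprVn.
rewrite big_split /= mulrA; congr (_ * _).
rewrite prodfV -expr_sum -mdegE -{2}(subnK (ltnW (msize_mdeg_lt mg))) exprD.
by rewrite mulfK // expf_neq0.
Qed.

Lemma det_map_meval d m (M : 'M[{mpoly F[d]}]_m) v :
  (\det M).@[v] = \det (map_mx (meval v) M).
Proof. by rewrite -det_map_mx. Qed.

(* In the chart of J', the chart coordinates x of a point with respect to J are
   polynomials divided by a common k x k minor; multiplying by powers of this
   minor makes the condition g(x) = 0 polynomial, and automatic outside the
   chart of J. *)
Lemma chart_locus_closed J (g : {mpoly F[#|~: J| * #|J|]}) : #|J| = k ->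
  gr_closed [set X : Gr F n k | forall x, val X = chart (J := J) x -> g.@[x 0] = 0].
Proof.
move=> Jk J' J'k; have JJ' : #|J| = #|J'| by rewrite Jk.
pose b (y : 'rV[F]_(#|~: J'| * #|J'|)) (j : 'I_#|J|) := chart_col y (cast_ord JJ' j).
have imb y : [seq b y j | j : 'I_#|J|] = [seq chart_col y j | j : 'I_#|J'|].
  apply: (@eq_from_nth _ 0) => [|i]; rewrite !size_image !card_ord // => iJ.
  have iJ' : (i < #|J'|)%N by rewrite -JJ'.
  transitivity (b y (Ordinal iJ)).
    exact: (nth_mktuple (b y) 0 (Ordinal iJ)).
  apply: etrans (esym (nth_mktuple (chart_col y) 0 (Ordinal iJ'))).
  by congr chart_col; apply: val_inj.
have freeb y : free [tuple b y j | j < #|J|].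
  have -> : [tuple b y j | j < #|J|] = [tuple chart_col y j | j < #|J'|] :> seq _.
    exact: imb.
  exact: free_chart_col.
pose p (l : 'I_n) (j : 'I_#|J|) : {mpoly F[#|~: J'| * #|J'|]} :=
  (((delta_mx (enum_val (cast_ord JJ' j)) 0 : 'cV[F]_n) l 0)%:MP +
   \sum_i ((delta_mx (enum_val i) 0 : 'cV[F]_n) l 0)%:MP *
     'X_(mxvec_index i (cast_ord JJ' j)))%R.
have pE (y : 'rV[F]_(#|~: J'| * #|J'|)) l j : (p l j).@[y 0] = b y j l 0.
  rewrite /b /chart_col mxE summxE mevalD mevalC raddf_sum; congr (_ + _).
  apply: eq_bigr => i _; rewrite [RHS]mxE /= mevalM mevalC mevalXU mulrC; congr (_ * _).
  by rewrite mxE.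
pose PI : 'M_#|J| := \matrix_(i, j) p (enum_val i) j.
pose PO : 'M_(#|~: J|, #|J|) := \matrix_(i, j) p (enum_val i) j.
have PIE (y : 'rV[F]_(#|~: J'| * #|J'|)) : map_mx (meval (y 0)) PI = rows_in (b y).
  by apply/matrixP => i j; rewrite mxE [PI _ _]mxE pE [RHS]mxE.
have POE (y : 'rV[F]_(#|~: J'| * #|J'|)) : map_mx (meval (y 0)) PO = rows_out (b y).
  by apply/matrixP => i j; rewrite mxE [PO _ _]mxE pE [RHS]mxE.
pose D := \det PI.
have DE (y : 'rV[F]_(#|~: J'| * #|J'|)) : D.@[y 0] = \det (rows_in (b y)).
  by rewrite det_map_meval PIE.
have [h hE] := clear_denominators g (fun e => mxvec (PO *m \adj PI) 0 e) D.
(* [h] is controlled only where [D] is nonzero; the extra factor [D] makes the equation hold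
   elsewhere. *)
exists [set D * h]; apply/predeqP => y; rewrite /in_chart /zeros /=.
transitivity (forall x, chart y = chart (J := J) x -> g.@[x 0] = 0).
  split=> [[X XW yX] x xy|W]; first by apply: XW; rewrite yX.
  by exists (gr_chart J'k y).
have chartE x : chart y = chart (J := J) x <->
    \det (rows_in (b y)) != 0 /\ x = mxvec (rows_out (b y) *m invmx (rows_in (b y))).
  by rewrite -span_eq_chartP // imb.
have xE : \det (rows_in (b y)) != 0 ->
    h.@[y 0] = D.@[y 0] ^+ msize g *
      g.@[mxvec (rows_out (b y) *m invmx (rows_in (b y))) 0].
  rewrite -DE => Dy; rewrite hE //; congr (_ * _); apply: meval_eq => e.
  case/mxvec_indexP: e => i j; rewrite !mxvecE /invmx unitmxE unitfE -DE Dy.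
  rewrite -scalemxAr [RHS]mxE; congr (_ * _); rewrite -POE -PIE.
  rewrite -map_mx_adj -map_mxM.
  by rewrite [RHS]mxE.
split=> [gx f ->|Dh x /chartE[dB ->]].
  rewrite mevalM; have [/eqP|dB] := boolP (\det (rows_in (b y)) == 0).
    by rewrite -DE => ->; rewrite mul0r.
  by rewrite xE // gx ?mulr0 //; apply/chartE.
have /eqP := Dh _ erefl; rewrite mevalM xE // !mulf_eq0 expf_eq0 DE (negPf dB) andbF.
by move=> /eqP.
Qed.

Lemma gr_closure_chart_locus J (g : {mpoly F[#|~: J| * #|J|]})
    (V : set (Gr F n k)) : #|J| = k ->
  (forall X, V X -> forall x, val X = chart (J := J) x -> g.@[x 0] = 0) ->
  vanishing_ideal (in_chart (J := J) (gr_closure V)) g.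
Proof.
by move=> Jk Vg x [X + Xx] => /(_ _ (chart_locus_closed g Jk) Vg); apply.
Qed.

End ClosedLoci.

(** * The torus action *)

Section TorusAction.
Variables (F : fieldType) (n k : nat).
Implicit Types (X Y Z : Gr F n k) (J : {set 'I_n}) (t : 'rV[F]_n).

(** Scaling the rows by [t] turns the identity block into a diagonal one; restoring it divides
    column [j] by its entry of [t]. *)
Definition torus_chart J t (x : 'rV[F]_(#|~: J| * #|J|)) :=
  mxvec (\matrix_(i, j) (t 0 (enum_val i) * vec_mx x i j / t 0 (enum_val j))).

Lemma torus_lfunE t (v : 'cV[F]_n) i :
  (linfun (mulmx (diag_mx t)) v) i 0 = t 0 i * v i 0.
Proof. by rewrite lfunE /= mul_diag_mx mxE. Qed.

Lemma vec_torus_chart J t (x : 'rV[F]_(#|~: J| * #|J|)) i j :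
  vec_mx (torus_chart t x) i j =
  t 0 (enum_val i) * vec_mx x i j / t 0 (enum_val j).
Proof. by rewrite mxvecK mxE. Qed.

Lemma torus_chartE J t (x : 'rV[F]_(#|~: J| * #|J|)) : (forall i, t 0 i != 0) ->
  (linfun (mulmx (diag_mx t)) @: chart x)%VS = chart (torus_chart t x).
Proof.
move=> t0; apply/vspaceP => v; apply/memv_imgP/memv_chartP.
  case=> w /memv_chartP wx -> i; rewrite torus_lfunE wx mulr_sumr.
  apply: eq_bigr => j _; rewrite torus_lfunE vec_torus_chart !mulrA.
  by rewrite divfK.
move=> vx; exists (\col_i ((t 0 i)^-1 * v i 0)).
  apply/memv_chartP => i; rewrite mxE vx mulr_sumr; apply: eq_bigr => j _.
  by rewrite vec_torus_chart [(\col_l _) _ _]mxE !mulrA mulVf // mul1r.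
by apply/colP => i; rewrite torus_lfunE mxE mulrA divff // mul1r.
Qed.

Lemma torus_chartM J s t (x : 'rV[F]_(#|~: J| * #|J|)) :
  torus_chart s (torus_chart t x) = torus_chart (\row_i (s 0 i * t 0 i)) x.
Proof.
congr mxvec; apply/matrixP => i j; rewrite mxE vec_torus_chart [RHS]mxE.
rewrite ![(\row_l _) _ _]mxE invfM !mulrA.
by rewrite mulrAC.
Qed.

Lemma torus_chart1 J (x : 'rV[F]_(#|~: J| * #|J|)) :
  torus_chart (const_mx 1) x = x.
Proof.
rewrite -[RHS]vec_mxK; congr mxvec; apply/matrixP => i j.
by rewrite mxE !mxE mul1r divr1.
Qed.

Lemma torus_orbit_chartP J X Z (x : 'rV[F]_(#|~: J| * #|J|)) : val X = chart x ->
  torus_orbit X Z <->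
  exists2 t : 'rV[F]_n, (forall i, t 0 i != 0) & val Z = chart (torus_chart t x).
Proof.
move=> Xx; split=> -[t t0 Zt]; exists t => //.
  by rewrite Zt Xx torus_chartE.
by rewrite Zt Xx torus_chartE.
Qed.

Lemma torus_orbit_subset J X Y t (x : 'rV[F]_(#|~: J| * #|J|)) :
  (forall i, t 0 i != 0) -> val X = chart x -> val Y = chart (torus_chart t x) ->
  torus_orbit Y `<=` torus_orbit X.
Proof.
move=> t0 Xx Yx Z /(torus_orbit_chartP _ Yx)[s s0 Zs].
apply/(torus_orbit_chartP _ Xx); eexists; last by rewrite Zs torus_chartM.
by move=> i; rewrite mxE mulf_neq0.
Qed.

Lemma torus_orbit_eq J X Y t (x : 'rV[F]_(#|~: J| * #|J|)) :
  (forall i, t 0 i != 0) -> val X = chart x -> val Y = chart (torus_chart t x) ->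
  torus_orbit X = torus_orbit Y.
Proof.
move=> t0 Xx Yx; apply/seteqP; split; last exact: torus_orbit_subset Xx Yx.
apply: (@torus_orbit_subset _ _ _ (\row_i (t 0 i)^-1) _ _ Yx).
  by move=> i; rewrite mxE invr_eq0.
rewrite torus_chartM Xx -[in LHS](torus_chart1 x); congr (chart (torus_chart _ x)).
by apply/rowP => i; rewrite !mxE mulVf.
Qed.

Lemma has_chart_orbit X Z J : #|J| = k ->
  torus_orbit X Z -> has_chart Z J -> has_chart X J.
Proof.
move=> Jk [t t0 Zt] /has_chartP trZ; apply/has_chartP => // v vX v0.
have tv0 : linfun (mulmx (diag_mx t)) v = 0.
  apply: trZ => // [|i iJ]; first by rewrite Zt memv_img.
  by rewrite torus_lfunE v0 ?mulr0.
apply/colP => i; have /colP/(_ i) := tv0; rewrite torus_lfunE !mxE.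
by move/eqP; rewrite mulf_eq0 (negPf (t0 i)) => /eqP.
Qed.

(** Charts are open: for g = 1 the closed locus of [chart_locus_closed] is the complement of the
    chart of [J]. An orbit inside it has its closure inside it. *)
Lemma has_chart_orbit_closure X Z J : #|J| = k ->
  orbit_closure X Z -> has_chart Z J -> has_chart X J.
Proof.
move=> Jk /(_ _ (chart_locus_closed 1 Jk)) clZ [z Zz]; apply: contrapT => nX.
suff /clZ/(_ z Zz)/eqP : torus_orbit X `<=`
    [set Y | forall y, val Y = chart (J := J) y -> (1 : {mpoly F[_]}).@[y 0] = 0].
  by rewrite meval1 oner_eq0.
move=> Y XY y Yy; case: nX; apply: has_chart_orbit XY _ => //.
by exists y.
Qed.

End TorusAction.

(** * Limits of one-parameter families in an orbit *)

Section TorusLimits.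
Variables (F : numFieldType) (n k : nat).
Implicit Types (X Y Z : Gr F n k) (J : {set 'I_n}) (t : 'rV[F]_n).

Lemma orbit_closure_limit J X (x : 'rV[F]_(#|~: J| * #|J|))
    (q : 'I_(#|~: J| * #|J|) -> {poly F}) :
  #|J| = k -> val X = chart x ->
  (forall a, a != 0 -> exists2 t : 'rV[F]_n, (forall i, t 0 i != 0) &
     \row_e (q e).[a] = torus_chart t x) ->
  in_chart (J := J) (orbit_closure X) (\row_e (q e).[0]).
Proof.
move=> Jk Xx qx; exists (gr_chart Jk (\row_e (q e).[0])) => // W Wcl XW.
have [a /qx[t t0 qt]|Z WZ Zq] := affine_closed_curve (Wcl J Jk) (q := q).
  exists (gr_chart Jk (\row_e (q e).[a])) => //; apply: XW.
  by apply/(torus_orbit_chartP _ Xx); exists t; rewrite //= qt.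
by rewrite -(_ : Z = gr_chart Jk (\row_e (q e).[0])) //; apply: val_inj.
Qed.

(** The torus element equal to 1 on [J] and to [a] off [J] multiplies all chart coordinates by [a],
    which then tends to 0. *)
Lemma orbit_closure_origin J X (x : 'rV[F]_(#|~: J| * #|J|)) :
  #|J| = k -> val X = chart x -> in_chart (J := J) (orbit_closure X) 0.
Proof.
move=> Jk Xx.
have -> : 0 = \row_e (x 0 e *: 'X).[0].
  by apply/rowP => e; rewrite !mxE hornerZ hornerX mulr0.
apply: (orbit_closure_limit Jk Xx) => a a0.
exists (\row_i (if i \in J then 1 else a)).
  by move=> i; rewrite mxE; case: ifP; rewrite ?oner_eq0.
apply/rowP => e; rewrite mxE; case/mxvec_indexP: e => i j.
have iJ := enum_valP i; rewrite inE in iJ.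
by rewrite mxvecE !mxE (negPf iJ) enum_valP divr1 hornerZ hornerX mulrC.
Qed.

(** For [b] nonzero, torus elements are chosen that send the coordinate (i, j) to [b] and multiply
    every other one by a constant times [a] or [a ^+ 2], so that only the first survives at a =
    0. *)
Lemma orbit_closure_axis J X (x : 'rV[F]_(#|~: J| * #|J|)) e b :
  #|J| = k -> val X = chart x -> x 0 e != 0 ->
  in_chart (J := J) (orbit_closure X) (b *: delta_mx 0 e).
Proof.
move=> Jk Xx; have [->|b0] := eqVneq b 0.
  by rewrite scale0r => _; apply: orbit_closure_origin Jk Xx.
case/mxvec_indexP: e => i j xij.
pose M := \matrix_(i' < #|~: J|, j' < #|J|) (vec_mx x i' j' *:
  ((if i' == i then (b / vec_mx x i j)%:P else 'X) *
   (if j' == j then 1 else 'X))) : 'M[{poly F}]_(_, _).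
have x0 : vec_mx x i j != 0 by rewrite mxE.
have -> : b *: delta_mx 0 (mxvec_index i j) = \row_e (mxvec M 0 e).[0].
  apply/rowP => e; case/mxvec_indexP: e => i' j'.
  rewrite [RHS]mxE mxvecE [M _ _]mxE hornerZ hornerM [LHS]mxE -mxvec_delta mxvecE.
  rewrite [delta_mx _ _ _ _]mxE.
  case: eqP => [->|_]; last by rewrite hornerX mul0r !mulr0.
  case: eqP => [->|_]; last by rewrite hornerX !mulr0.
  by rewrite !hornerC !mulr1 mulrC divfK.
apply: (orbit_closure_limit Jk Xx) => a a0.
exists (\row_l (if l \in J then (if l == enum_val j then 1 else a^-1)
                else (if l == enum_val i then b / vec_mx x i j else a))).
  move=> l; rewrite mxE; case: ifP => _; case: ifP => _ //.
  - by rewrite oner_eq0.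
  - by rewrite invr_eq0.
  - by rewrite mulf_neq0 ?invr_eq0.
apply/rowP => e; rewrite mxE; case/mxvec_indexP: e => i' j'.
have iJ := enum_valP i'; rewrite inE in iJ.
rewrite !mxvecE [M _ _]mxE [RHS]mxE ![(\row_l _) _ _]mxE (negPf iJ) enum_valP.
rewrite !(inj_eq enum_val_inj) hornerZ hornerM -[RHS]mulrA [RHS]mulrCA.
by congr (_ * (_ * _)); case: eqP => _; rewrite ?hornerC ?hornerX ?invr1 ?invrK.
Qed.

End TorusLimits.

(** * Monomial maps *)

Section MultiplicativeMaps.
Variable F : fieldType.

(** On nonzero entries this is the homomorphism of tori with exponent matrix [A]; matrix products
    become compositions. *)
Definition monomial_map m n (A : 'M[int]_(m, n)) (t : 'I_n -> F) (i : 'I_m) : F :=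
  \prod_l t l ^ A i l.

Lemma expfz_sum (I : Type) (r : seq I) (z : I -> int) (a : F) : a != 0 ->
  a ^ (\sum_(i <- r) z i) = \prod_(i <- r) a ^ z i.
Proof.
move=> a0; apply: (big_morph (fun z : int => a ^ z)) => [x y|]; last exact: expr0z.
exact: expfzDr.
Qed.

Lemma prod_expfz (I : Type) (r : seq I) (a : I -> F) (z : int) :
  (\prod_(i <- r) a i) ^ z = \prod_(i <- r) a i ^ z.
Proof.
apply: (big_morph (fun a : F => a ^ z)) => [x y|]; first exact: expfzMl.
exact: exp1rz.
Qed.

Lemma monomial_map_neq0 m n (A : 'M[int]_(m, n)) t : (forall l, t l != 0) ->
  forall i, monomial_map A t i != 0.
Proof. by move=> t0 i; apply/prodf_neq0 => l _; apply: expfz_neq0. Qed.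

Lemma monomial_map_mul m n p (A : 'M[int]_(m, n)) (B : 'M_(n, p)) t :
  (forall l, t l != 0) ->
  monomial_map (A *m B) t =1 monomial_map A (monomial_map B t).
Proof.
move=> t0 i; rewrite /monomial_map.
under eq_bigr do rewrite mxE expfz_sum //.
rewrite exchange_big; apply: eq_bigr => h _; rewrite prod_expfz.
by apply: eq_bigr => l _; rewrite exprz_exp mulrC.
Qed.

Lemma monomial_map1 n t : @monomial_map n n 1%:M t =1 t.
Proof.
move=> i; rewrite /monomial_map (bigD1 i) //= mxE eqxx big1 ?mulr1 // => l li.
by rewrite mxE eq_sym (negPf li).
Qed.

Lemma eq_monomial_map m n (A : 'M[int]_(m, n)) t s :
  t =1 s -> monomial_map A t =1 monomial_map A s.
Proof. by move=> ts i; apply: eq_bigr => l _; rewrite ts. Qed.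

End MultiplicativeMaps.

Lemma expfz_surjective (F : numClosedFieldType) (z : int) (c : F) :
  z != 0 -> c != 0 -> exists2 a, a != 0 & a ^ z = c.
Proof.
have rt N (b : F) : b != 0 -> exists2 a, a != 0 & a ^+ N.+1 = b.
  move=> b0; have bE := rootCK (ltn0Sn N) b; exists (N.+1.-root b) => //.
  by apply: contra_neq b0 => a0; rewrite -bE a0 expr0n.
case: z => [[|N]|N] // _ c0; first exact: rt.
have [a a0 aE] := rt N _ c0; exists a^-1; first by rewrite invr_eq0.
by rewrite NegzE exprz_inv opprK.
Qed.

(* The map is onto because it is so for a diagonal matrix with nonzero diagonal
   entries, to which the Smith normal form reduces. *)
Lemma monomial_map_surjective (F : numClosedFieldType) m n (M : 'M[int]_(m, n)) :
  (forall v : 'rV_m, v *m M = 0 -> v = 0) ->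
  forall c : 'I_m -> F, (forall i, c i != 0) ->
  exists2 t, (forall l, t l != 0) & monomial_map M t =1 c.
Proof.
have [L Lu [R Ru [d _ ->]]] := int_Smith_normal_form M.
set D := \matrix_(i, j) _ => injM c c0.
(* A zero row of [D] would give a nonzero vector in the left kernel of [M]. So every row has a
   nonzero diagonal entry, and m <= n. *)
have D0 (i : 'I_m) : exists2 l : 'I_n, i = l :> nat & d`_i != 0.
  have [/eqP Di|/rV0Pn[l]] := boolP (row i D == 0); last first.
    rewrite !mxE; have [il|_] := eqVneq (i : nat) l; last by rewrite mulr0n eqxx.
    by exists l.
  have : delta_mx 0 i *m invmx L = 0 :> 'rV_m.
    apply: injM; rewrite !mulmxA mulmxKV //.
    by rewrite -rowE Di mul0mx.
  move/(congr1 (mulmx^~ L)); rewrite mulmxKV // mul0mx => /rowP/(_ i).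
  by rewrite !mxE !eqxx.
pose c' := monomial_map (invmx L) c.
have c'0 := monomial_map_neq0 (invmx L) c0.
have [u uP] : {u : 'I_n -> F & forall l, u l != 0 /\
    forall i : 'I_m, i = l :> nat -> u l ^ d`_i = c' i}.
  apply: (choice (P := fun (l : 'I_n) (a : F) => a != 0 /\
    forall i : 'I_m, i = l :> nat -> a ^ d`_i = c' i)).
  move=> l; have [lm|ml] := ltnP l m; last first.
    (* Columns beyond the diagonal impose no condition, so any nonzero value will do. *)
    exists 1; split; first exact: oner_neq0.
    by move=> i il; have := ltn_ord i; rewrite il ltnNge ml.
  have [l' _ dl] := D0 (Ordinal lm).
  have [a a0 aE] := expfz_surjective dl (c'0 (Ordinal lm)).
  by exists a; split=> // i il; have -> : i = Ordinal lm by apply: val_inj.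
have u0 l : u l != 0 by have [] := uP l.
have Du : monomial_map D u =1 c'.
  move=> i; have [l il _] := D0 i; have [_ <- //] := uP l.
  rewrite /monomial_map (bigD1 l) //= mxE il eqxx mulr1n big1 ?mulr1 // => l' l'l.
  rewrite mxE [_ == _ :> nat](_ : _ = false) ?mulr0n //.
  by apply/eqP => ll'; case/eqP: l'l; apply: val_inj; rewrite /= -ll'.
exists (monomial_map (invmx R) u); first exact: monomial_map_neq0.
have t0 := monomial_map_neq0 (invmx R) u0.
have tE : monomial_map (D *m R) (monomial_map (invmx R) u) =1 c'.
  by move=> j; rewrite -monomial_map_mul // mulmxK.
move=> i; rewrite -mulmxA monomial_map_mul // (eq_monomial_map L tE).
by rewrite -monomial_map_mul // mulmxV // monomial_map1.
Qed.

(** * Smoothness and weights *)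

Section SmoothCharts.
Variables (F : numClosedFieldType) (n k : nat) (J : {set 'I_n}).
Hypothesis Jk : #|J| = k.
Implicit Types (X Y : Gr F n k) (x y : 'rV[F]_(#|~: J| * #|J|)).

Definition chart_weights : 'M[int]_(#|~: J| * #|J|, n) :=
  \matrix_(e, l) mxvec (\matrix_(i < #|~: J|, j < #|J|)
    ((l == enum_val i)%:Z - (l == enum_val j)%:Z)) 0 e.

Lemma prod_expz_indicator (t : 'I_n -> F) i : \prod_l t l ^ (l == i)%:Z = t i.
Proof.
rewrite (bigD1 i) //= eqxx big1 ?mulr1 ?expr1z // => l /negPf ->.
by rewrite expr0z.
Qed.

Lemma torus_chart_weights (t : 'rV[F]_n) x e : (forall l, t 0 l != 0) ->
  torus_chart t x 0 e = monomial_map chart_weights (t 0) e * x 0 e.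
Proof.
move=> t0; case/mxvec_indexP: e => i j; rewrite mxvecE mxE [vec_mx _ _ _]mxE mulrAC.
congr (_ * _); rewrite /monomial_map.
under [RHS]eq_bigr do rewrite mxE mxvecE mxE expfzDr // -invr_expz.
by rewrite big_split /= prodfV !prod_expz_indicator.
Qed.

Definition chart_support x : {set 'I_(#|~: J| * #|J|)} := [set e | x 0 e != 0]%SET.

Definition support_weights x := rowsub (@enum_val _ (mem (chart_support x))) chart_weights.

Lemma support_weightsE x (t : 'I_n -> F) e :
  monomial_map (support_weights x) t e = monomial_map chart_weights t (enum_val e).
Proof. by apply: eq_bigr => l _; rewrite mxE. Qed.

Lemma in_chart_closure_supported X x : val X = chart x ->
  in_chart (J := J) (orbit_closure X) `<=` supported_on (chart_support x).
Proof.
move=> Xx y Sy e; rewrite inE negbK => /eqP xe.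
rewrite -(mevalXU (y 0) e); apply: (gr_closure_chart_locus Jk) Sy.
move=> Z /(torus_orbit_chartP _ Xx)[t t0 ->] z /chart_inj <-.
by rewrite mevalXU torus_chart_weights // xe mulr0.
Qed.

(* If the weights of the nonzero coordinates of x satisfied a linear relation,
   the corresponding binomial would vanish on the orbit closure, which is dense
   in the coordinate subspace spanned by its tangent space at the fixed point. *)
Lemma smooth_support_weights X x : val X = chart x ->
  smooth_at (in_chart (J := J) (orbit_closure X)) 0 ->
  forall v : 'rV_#|chart_support x|, v *m support_weights x = 0 -> v = 0.
Proof.
move=> Xx smX v vW; set E := chart_support x; rewrite -/E in v vW *.
(* [p] and [q] are the positive and negative parts of [v]; [Negz a] stands for -(a + 1). *)
pose p := [multinom (if v 0%R e is Posz a then a else 0%N) | e < #|E|].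
pose q := [multinom (if v 0%R e is Negz a then a.+1 else 0%N) | e < #|E|].
have vpq e : v 0 e = (p e)%:Z - (q e)%:Z.
  by rewrite !mnmE; case: (v 0 e) => a; rewrite ?subr0 ?sub0r // NegzE.
pose xe (e : 'I_#|E|) := x 0 (enum_val e).
have xe0 e : xe e != 0 by have := enum_valP e; rewrite inE.
pose X_ (u : 'X_{1.. #|E|}) : {mpoly F[#|~: J| * #|J|]} :=
  \prod_(e < #|E|) 'X_(enum_val e) ^+ u e.
pose c (u : 'X_{1.. #|E|}) := \prod_e xe e ^+ u e.
(* The coefficients make the binomial vanish at [x]. The torus multiplies the two monomials by the
   values of two characters, which agree because of [vW]. *)
pose g := c q *: X_ p - c p *: X_ q.
have Sg : vanishing_ideal (in_chart (J := J) (orbit_closure X)) g.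
  apply: (gr_closure_chart_locus Jk) => Z /(torus_orbit_chartP _ Xx)[t t0 ->].
  move=> _ /chart_inj <-.
  pose w (e : 'I_#|E|) := monomial_map chart_weights (t 0) (enum_val e).
  have w0 e : w e != 0 by apply: monomial_map_neq0.
  have X_E u : (X_ u).@[torus_chart t x 0] = (\prod_e w e ^+ u e) * c u.
    rewrite rmorph_prod /= -big_split; apply: eq_bigr => e _ /=.
    by rewrite rmorphXn /= mevalXU torus_chart_weights // exprMn.
  rewrite mevalB !mevalZ !X_E.
  suff -> : \prod_e w e ^+ p e = \prod_e w e ^+ q e.
    by rewrite mulrCA [X in _ - X]mulrCA [c q * _]mulrC subrr.
  have : monomial_map v (fun e => w e) 0 = 1.
    have wE : monomial_map (support_weights x) (t 0) =1 w.
      by move=> e; apply: support_weightsE.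
    rewrite -(eq_monomial_map v wE) -monomial_map_mul // vW.
    by rewrite /monomial_map big1 // => l _; rewrite mxE expr0z.
  rewrite /monomial_map; under eq_bigr do rewrite vpq expfzDr // -invr_expz.
  rewrite big_split /= prodfV => /(canRL (mulfVK _)) ->; rewrite ?mul1r //.
  by apply/prodf_neq0 => e _; apply: expf_neq0.
have /mpolyP/(_ p) : coord_restrict E g = 0.
  apply: smooth_at0_restrict_eq0 smX Sg; first exact: in_chart_closure_supported.
  by move=> e a; rewrite inE => xe'; apply: orbit_closure_axis Jk Xx xe'.
have resX u : coord_restrict E (X_ u) = 'X_[u].
  rewrite rmorph_prod mpolyXE_id; apply: eq_bigr => e _.
  by rewrite rmorphXn /= coord_restrict_X.
rewrite rmorphB /= !coord_restrictZ !resX mcoeffB !mcoeffZ !mcoeffX eqxx mcoeff0.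
(* If [p] and [q] differed, the coefficient at [p] would be [c q], a product of nonzero coordinates
   of [x]. *)
have [qp _|_ /eqP] := eqVneq q p; last first.
  rewrite mulr0 subr0 mulr1 prodf_seq_eq0 => /hasP[e _ /=].
  by rewrite expf_eq0 (negPf (xe0 e)) andbF.
by apply/rowP => e; rewrite vpq qp subrr mxE.
Qed.

(** The torus element sought has prescribed character values y_e / x_e on the support. Independence
    of the weights makes the monomial map onto, so it exists. *)
Lemma smooth_orbit_determined X Y x y :
  val X = chart x -> val Y = chart y ->
  chart_support x = chart_support y ->
  smooth_at (in_chart (J := J) (orbit_closure X)) 0 ->
  torus_orbit X = torus_orbit Y.
Proof.
move=> Xx Yy xy smX.
pose c (e : 'I_#|chart_support x|) := y 0 (enum_val e) / x 0 (enum_val e).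
have c0 e : c e != 0.
  have ye : enum_val e \in chart_support y by rewrite -xy enum_valP.
  have := enum_valP e; rewrite !inE in ye *.
  by rewrite mulf_eq0 invr_eq0 negb_or ye.
have [t t0 tE] := monomial_map_surjective (smooth_support_weights Xx smX) c0.
have t0' l : (\row_l t l) 0 l != 0 by rewrite mxE.
apply: (torus_orbit_eq t0' Xx); rewrite Yy; congr chart; apply/rowP => e.
rewrite torus_chart_weights //.
have [eE|] := boolP (e \in chart_support x); last first.
  move=> eE; have := eE; rewrite {1}xy !inE !negbK => /eqP ->.
  by move: eE; rewrite inE negbK => /eqP ->; rewrite mulr0.
have tt : (\row_l t l) 0 =1 t by move=> l; rewrite mxE.
rewrite (eq_monomial_map _ tt) -(enum_rankK_in eE eE) -support_weightsE tE divfK //.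
by rewrite enum_rankK_in //; move: eE; rewrite inE.
Qed.

End SmoothCharts.

(** * The moment map *)

Section MomentMap.
Variables (R : realType) (n k : nat).
Implicit Types (X Y Z : Gr R[i] n k) (J : {set 'I_n}).

Lemma plucker_weight_ge0 X J : 0 <= plucker_weight X J.
Proof. exact: sqr_ge0. Qed.

Lemma plucker_weight_neq0P X J : #|J| = k ->
  plucker_weight X J != 0 <-> has_chart X J.
Proof.
move=> Jk; rewrite -plucker_neq0P // /plucker_weight expf_eq0 /=.
split; apply: contra_neq; last exact: Normc.eq0_normc.
by move=> ->; apply: Normc.normc0.
Qed.

(** For [i] outside [J], the i-th coordinate is a vanishing sum of nonnegative terms, so no set of
    nonzero weight contains [i]. A set of nonzero weight therefore lies in [J], and equals it by
    cardinality. *)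
Lemma moment_map_indicator Z J : #|J| = k ->
  moment_map Z = indicator R J -> has_chart Z J.
Proof.
move=> Jk muZ; have [J1 [J1k ZJ1]] := has_chart_exists Z.
have w1 : plucker_weight Z J1 != 0 by apply/plucker_weight_neq0P.
suff -> : J = J1 by [].
apply/esym/eqP; rewrite eqEcard Jk J1k leqnn andbT.
apply/fintype.subsetP => i iJ1; apply/negPn/negP => iJ; case/eqP: w1.
have /rowP/(_ i) := muZ; rewrite !mxE (negPf iJ) => /eqP.
have s0 : \sum_(J' : {set 'I_n} | #|J'| == k) plucker_weight Z J' != 0.
  rewrite psumr_neq0; last by move=> *; apply: plucker_weight_ge0.
  apply/hasP; exists J1; first by rewrite mem_index_enum.
  rewrite J1k eqxx lt_neqAle plucker_weight_ge0 andbT eq_sym.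
  exact/plucker_weight_neq0P.
rewrite mulf_eq0 invr_eq0 (negPf s0) summxE psumr_eq0; last first.
  by move=> J' _; rewrite !mxE mulr_ge0 ?plucker_weight_ge0 ?ler0n.
move=> /allP/(_ J1); rewrite mem_index_enum J1k eqxx => /(_ isT).
by rewrite !mxE iJ1 mulr1 => /eqP.
Qed.

Lemma moment_map_coordinate J (Jk : #|J| = k) :
  moment_map (gr_chart Jk 0 : Gr R[i] n k) = indicator R J.
Proof.
set Z := gr_chart _ _.
have w0 J' : #|J'| == k -> J' != J -> plucker_weight Z J' = 0.
  move=> /eqP J'k; apply: contra_neq_eq => /(plucker_weight_neq0P _ J'k).
  exact: has_chart_coordinate.
have wJ : plucker_weight Z J != 0 by apply/plucker_weight_neq0P => //; exists 0.
rewrite /moment_map !(bigD1 J (P := fun J' => #|J'| == k)) ?Jk //=.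
rewrite !big1 ?addr0 => [|J' /andP[J'k /(w0 _ J'k) ->]|J' /andP[J'k /w0->//]];
  rewrite ?scale0r //.
by rewrite scalerA mulVf // scale1r.
Qed.

(** The coordinate subspace of [J] is in the closure of the orbit of [X] and maps to the vertex of
    [J]. A point over this vertex in the other closure lies in the chart of [J], which is open, so
    [Y] does too. *)
Lemma has_chart_moment X Y J : #|J| = k ->
  @moment_map R n k @` orbit_closure X `<=` @moment_map R n k @` orbit_closure Y ->
  has_chart X J -> has_chart Y J.
Proof.
move=> Jk XY [x Xx].
have [Z clZ Z0] := orbit_closure_origin Jk Xx.
have ZE : Z = gr_chart Jk 0 by apply: val_inj.
have /XY[Z' clZ' muZ'] : (@moment_map R n k @` orbit_closure X) (indicator R J).
  by exists Z => //; rewrite ZE moment_map_coordinate.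
by apply: has_chart_orbit_closure clZ' _ => //; apply: moment_map_indicator.
Qed.

End MomentMap.

Theorem mainTheorem3 (R : realType) (n k : nat) (hk : (k <= n)%N)
    (hn : (1 <= n)%N) (X Y : Gr R[i] n k)
    (hX : gr_smooth (orbit_closure X)) (hY : gr_smooth (orbit_closure Y))
    (hXY : @moment_map R n k @` orbit_closure X =
           @moment_map R n k @` orbit_closure Y) :
  orbit_closure X = orbit_closure Y.
Proof.
have bases (J : {set 'I_n}) : #|J| = k -> has_chart X J <-> has_chart Y J.
  by move=> Jk; split; apply: has_chart_moment => //; rewrite hXY.
have [J [Jk XJ]] := has_chart_exists X.
have [y Yy] := (bases J Jk).1 XJ; have [x Xx] := XJ.
have sm := hX J Jk 0 (orbit_closure_origin Jk Xx).
rewrite /orbit_closure (smooth_orbit_determined Jk Xx Yy _ sm) //.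
(* Equality of the supports: by exchange, each coordinate is tested by a chart, and both points lie
   in the same charts. *)
apply/setP => e; rewrite !inE; case/mxvec_indexP: e => i j.
have [J'k XJ'] := chart_exchange i j Jk Xx.
have [_ YJ'] := chart_exchange i j Jk Yy.
rewrite !mxE in XJ' YJ'.
by apply/idP/idP => [/XJ'/(bases _ J'k).1/YJ'|/YJ'/(bases _ J'k).2/XJ'].
Qed.
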